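(* For every integer $d\geq 10$ there exists a set $\mathcal{X}\subset\mathbb{R}^d$ of unit vectors spanning $|\mathcal{X}|=256+20N_{1/3}(d-10)$ biangular lines with $A(\mathcal{X})\subseteq\{\pm1/5,\pm3/5\}$.
   Context: For a finite set $\mathcal{X}\subset\mathbb{R}^d$ of unit vectors put $A(\mathcal{X}):=\{\langle x,x'\rangle\colon x\neq x';\ x,x'\in\mathcal{X}\}$. The set $\mathcal{X}$ spans a system of biangular lines (the lines through the origin in the directions $x\in\mathcal{X}$) if $-1\notin A(\mathcal{X})$ and $|\{\gamma^2\colon\gamma\in A(\mathcal{X})\}|\leq 2$. $N_{1/3}(k)$ denotes the maximum number of equiangular lines in $\mathbb{R}^k$ where the set of inner products is a subset of $\{\pm1/3\}$, i.e., the maximum of $|\mathcal{Y}|$ over sets $\mathcal{Y}\subset\mathbb{R}^k$ of unit vectors with $A(\mathcal{Y})\subseteq\{\pm1/3\}$; $N_{1/3}(0)=0$. *)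

(* Defs.v *)
From HB Require Import structures.
From mathcomp Require Import all_boot all_order all_algebra.
From mathcomp Require Import finmap.
From mathcomp Require Import boolp reals.
From mathcomp Require Import ring lra.

Set Implicit Arguments.
Unset Strict Implicit.
Unset Printing Implicit Defensive.

Import Order.TTheory GRing.Theory Num.Theory.
Local Open Scope ring_scope.

Section Biangular.
Variables (R : realType) (d : nat).
Implicit Types (x y : 'rV[R]_d) (X : {fset 'rV[R]_d}).

Definition inner x y : R := (x *m y^T) 0 0.

Definition unit_vectors X : Prop := forall x, x \in X -> inner x x = 1.

Definition inner_products X : {fset R} :=
  [fset inner x y | x in X, y in X `\ x]%fset.

(* The first condition says that the vectors of X span pairwise distinct
   lines, hence exactly #|` X| of them. *)
Definition spans_biangular_lines X : Prop :=
  -1 \notin inner_products X /\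
  (#|` [fset g ^+ 2 | g in inner_products X]%fset| <= 2)%N.

End Biangular.

Section MaxThird.
Variables (R : realType) (k : nat).

Definition third_set (Y : {fset 'rV[R]_k}) : Prop :=
  unit_vectors Y /\ (inner_products Y `<=` [fset 1 / 3; - (1 / 3)])%fset.

Definition third_size : pred nat :=
  fun n => `[< exists2 Y, third_set Y & #|` Y| = n >].

Lemma third_size_inhabited : exists n, third_size n.
Proof.
exists 0%N; apply/asboolP; exists fset0%fset; last by rewrite cardfs0.
split=> [x|]; first by rewrite in_fset0.
by apply/fsubsetP=> a /imfset2P[/= x]; rewrite inE.
Qed.

(* The Gram matrix of the y^T y, y in Y, for the entrywise inner product is
   8/9 I + 1/9 J, so these matrices are linearly independent. *)
Lemma third_size_le n : third_size n -> (n <= k * k)%N.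
Proof.
move=> /asboolP[Y [uY AY] <-].
pose y (i : 'I_#|` Y|) := nth 0 (enum_fset Y) i.
have yY i : y i \in Y by rewrite mem_nth.
have yi : injective y.
  move=> i j /eqP; rewrite /y nth_uniq ?fset_uniq // => /eqP ij.
  exact: val_inj.
pose B := \matrix_(i < #|` Y|) mxvec ((y i)^T *m y i).
have BBE i j : (B *m B^T) i j = inner (y i) (y j) ^+ 2.
  have -> : (B *m B^T) i j =
      (mxvec ((y i)^T *m y i) *m (mxvec ((y j)^T *m y j))^T) 0 0.
    rewrite !mxE; apply: eq_bigr => l _.
    by rewrite [B i l]mxE [B^T l j]mxE [B j l]mxE [_^T l 0]mxE.
  rewrite /inner mxE (reindex _ (curry_mxvec_bij k k)) /=.
  pose z a := y i 0 a * y j 0 a.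
  rewrite (eq_bigr (fun p => z p.1 * z p.2)) => [|[a b] _ /=].
    rewrite -(pair_bigA _ (fun a b => z a * z b)) /= expr2 [(_ *m _) 0 0]mxE.
    rewrite mulr_suml; apply: eq_bigr => a _; rewrite mulr_sumr.
    by apply: eq_bigr => b _; rewrite /z !mxE.
  by rewrite [_^T _ 0]mxE !mxvecE !mxE !big_ord1 !mxE /z; ring.
have GE i j : inner (y i) (y j) ^+ 2 = 8 / 9 * (i == j)%:R + 1 / 9.
  have [<-|ij] := eqVneq i j; first by rewrite uY // expr1n /=; lra.
  have /(fsubsetP AY) : inner (y i) (y j) \in inner_products Y.
    apply/imfset2P; exists (y i) => //; exists (y j) => //.
    rewrite !inE yY andbT; apply: contra ij => /eqP /yi ->; exact: eqxx.
  by rewrite !inE => /orP[] /eqP ->; rewrite /=; lra.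
have : row_free B; last first.
  by rewrite -row_leq_rank => /leq_trans; apply; rewrite rank_leq_col.
rewrite -kermx_eq0; apply/rowV0P => v /sub_kermxP vB.
have q0 : (v *m (B *m B^T) *m v^T) 0 0 = 0 by rewrite mulmxA vB !mul0mx mxE.
have qE : (v *m (B *m B^T) *m v^T) 0 0 =
    8 / 9 * (\sum_i v 0 i ^+ 2) + 1 / 9 * (\sum_i v 0 i) ^+ 2.
  have -> : B *m B^T = (8 / 9)%:M + const_mx (1 / 9).
    by apply/matrixP=> i j; rewrite BBE GE !mxE; case: eqP => _ /=;
      rewrite ?mulr1 ?mulr0 ?mulr1n ?mulr0n.
  rewrite mulmxDr mulmxDl mxE; congr (_ + _).
    rewrite mul_mx_scalar -scalemxAl mxE; congr (_ * _).
    by rewrite mxE; apply: eq_bigr => i _; rewrite mxE expr2.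
  rewrite mxE expr2 mulrA mulr_sumr; apply: eq_bigr => i _.
  rewrite !mxE; congr (_ * _); rewrite mulr_sumr.
  by apply: eq_bigr => l _; rewrite mxE mulrC.
have s0 : \sum_i v 0 i ^+ 2 = 0.
  have h1 : 0 <= \sum_i v 0 i ^+ 2 by apply: sumr_ge0 => i _; exact: sqr_ge0.
  have h2 := sqr_ge0 (\sum_i v 0 i).
  by move: q0; rewrite qE; move: h1 h2; set a := \sum_i _; set b := _ ^+ 2; lra.
apply/rowP => i; rewrite [RHS]mxE; apply/eqP; rewrite -sqrf_eq0.
have/eqP := s0; rewrite psumr_eq0 => [/allP/(_ i)|j _]; last exact: sqr_ge0.
by rewrite mem_index_enum => /(_ isT).
Qed.

Definition N_third : nat :=
  ex_maxn third_size_inhabited third_size_le.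

End MaxThird.

(* Main.v *)
Require Import Defs.
From mathcomp Require Import all_boot all_order all_algebra.
From mathcomp Require Import finmap.
From mathcomp Require Import boolp reals.
From mathcomp Require Import ring lra.

Import Order.TTheory GRing.Theory Num.Theory.
Local Open Scope ring_scope.

(** The even-weight sign vectors of length 10, taken up to sign and divided by
    [sqrt 10], are 256 unit vectors with inner products [±1/5] and [±3/5].
    Given [Y] in R^(d-10) with inner products [±1/3], add the [20 |Y|] vectors
    [(± sqrt (2/5) e_i, sqrt (3/5) y)]. Such a vector has inner product
    [± sqrt (2/5) / sqrt 10 = ±1/5] with each sign vector, and two of them have
    inner product [2/5 t + 3/5 <y, y'>] with [t] in [{0, 1, -1}]. *)

Section Inner.
Variable R : realType.

Lemma innerE d (x y : 'rV[R]_d) : inner x y = \sum_i x 0 i * y 0 i.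
Proof. by rewrite /inner mxE; apply: eq_bigr => i _; rewrite !mxE. Qed.

Lemma innerC d (x y : 'rV[R]_d) : inner x y = inner y x.
Proof. by rewrite !innerE; apply: eq_bigr => i _; rewrite mulrC. Qed.

Lemma innerZl d a (x y : 'rV[R]_d) : inner (a *: x) y = a * inner x y.
Proof. by rewrite /inner -scalemxAl mxE. Qed.

Lemma innerZr d a (x y : 'rV[R]_d) : inner x (a *: y) = a * inner x y.
Proof. by rewrite innerC innerZl innerC. Qed.

Lemma inner0r d (x : 'rV[R]_d) : inner x 0 = 0.
Proof. by rewrite /inner trmx0 mulmx0 mxE. Qed.

Lemma inner_delta d i (x : 'rV[R]_d) : inner (delta_mx 0 i) x = x 0 i.
Proof. by rewrite /inner -rowE !mxE. Qed.

Lemma inner_row_mx m n (x x' : 'rV[R]_m) (y y' : 'rV[R]_n) :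
  inner (row_mx x y) (row_mx x' y') = inner x x' + inner y y'.
Proof. by rewrite /inner tr_row_mx mul_row_col mxE. Qed.

End Inner.

Section Construction.
Variable R : realType.

Definition fifths : {fset R} :=
  [fset 1 / 5; - (1 / 5); 3 / 5; - (3 / 5)]%fset.

Lemma fifthsP a : reflect
  [\/ a = 1 / 5, a = - (1 / 5), a = 3 / 5 | a = - (3 / 5)] (a \in fifths).
Proof.
rewrite !inE -!orbA; apply: (iffP or4P) => -[] /eqP e; rewrite ?e;
  by [constructor 1|constructor 2|constructor 3|constructor 4].
Qed.

(** None of the four admissible values is -1, and their squares are only 1/25 and 9/25. *)
Lemma biangular_fifths d (X : {fset 'rV[R]_d}) :
  (inner_products X `<=` fifths)%fset -> spans_biangular_lines X.
Proof.
move=> /fsubsetP AX; split.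
  by apply/negP => /AX /fifthsP[] /eqP; apply/negP/eqP; lra.
apply: (@leq_trans #|` [fset 1 / 25; 9 / 25 : R]%fset|); last first.
  by rewrite cardfs2; case: (_ == _).
apply/fsubset_leq_card/fsubsetP => _ /imfsetP[/= a /AX /fifthsP aE ->].
rewrite !inE; case: aE => ->; apply/orP; [left|left|right|right];
  by apply/eqP; field.
Qed.

(** Two distinct indices with the same image would have inner product 1, which is not in [fifths];
    so [f] is injective and its image has as many elements as [T]. *)
Lemma fset_of_family d (T : finType) (f : T -> 'rV[R]_d) :
    (forall i, inner (f i) (f i) = 1) ->
    (forall i j, i != j -> inner (f i) (f j) \in fifths) ->
  exists X : {fset 'rV[R]_d},
    [/\ unit_vectors X, spans_biangular_lines X, #|` X| = #|T| &
        (inner_products X `<=` fifths)%fset].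
Proof.
move=> f1 fA.
have f_inj : injective f.
  move=> i j fij; apply/eqP/negPn/negP => /fA.
  by rewrite fij f1 => /fifthsP[] /eqP; apply/negP/eqP; lra.
have AX : (inner_products [fset f i | i : T] `<=` fifths)%fset.
  apply/fsubsetP => _ /imfset2P[/= x /imfsetP[/= i _ ->]] [y yX ->].
  case/fsetD1P: yX => fij /imfsetP[/= j _ yE]; rewrite yE.
  by apply: fA; apply: contraNneq fij => ->; rewrite yE.
exists [fset f i | i : T]%fset; split=> //.
- by move=> _ /imfsetP[/= i _ ->].
- exact: biangular_fifths.
- by rewrite card_imfset //= cardE; congr size.
Qed.

(** The first coordinate is fixed to [+1] to choose one vector of each
    antipodal pair, and the second one makes the number of signs [-1] even. *)
Definition even_bit (x : {ffun 'I_8 -> bool}) (j : nat) : bool :=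
  match j with
  | 0 => false
  | 1 => odd (\sum_i x i)
  | j.+2 => x (inord j)
  end.

Definition even_sign (x : {ffun 'I_8 -> bool}) : 'rV[R]_10 :=
  \row_(j < 10) (-1) ^+ even_bit x j.

(** Here [n] counts the disagreements in the eight free coordinates, which contribute [8 - 2 n]. The
    first coordinate contributes 1 and the second, a parity bit, contributes [(-1) ^+ n]. *)
Lemma even_sign_inner (x y : {ffun 'I_8 -> bool})
    (n := (\sum_i (x i (+) y i))%N) :
  inner (even_sign x) (even_sign y) = 9 + (-1) ^+ n - 2 * n%:R.
Proof.
have oddE : odd n = even_bit x 1 (+) even_bit y 1.
  rewrite /n /= !(big_morph odd oddD (erefl _)) -big_split /=.
  by apply: eq_bigr => i _; rewrite !oddb.
rewrite innerE (eq_bigr (fun j : 'I_10 =>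
  (-1) ^+ (even_bit x j (+) even_bit y j))) => [|j _]; last first.
  by rewrite !mxE signr_addb.
rewrite 2!big_ord_recl [lift _ _ : nat]/= -oddE signr_odd /=.
rewrite (eq_bigr (fun i => 1 - 2 * (x i (+) y i)%:R)) => [|i _]; last first.
  by rewrite !inord_val; case: (_ (+) _); rewrite /= ?expr1 ?expr0; ring.
rewrite sumrB sumr_const card_ord -mulr_sumr -natr_sum -/n; ring.
Qed.

Lemma even_sign_norm x : inner (even_sign x) (even_sign x) = 10.
Proof.
rewrite even_sign_inner big1 => [|i _]; last by rewrite addbb.
by rewrite expr0; ring.
Qed.

Lemma even_sign_fifths x y : x != y ->
  10^-1 * inner (even_sign x) (even_sign y) \in fifths.
Proof.
move=> xy; rewrite even_sign_inner; set n := (\sum_i _)%N.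
have n_gt0 : (0 < n)%N.
  rewrite lt0n sum_nat_eq0; apply: contraNN xy => /forallP xy0.
  apply/eqP/ffunP => i; have := xy0 i.
  by case: (x i) (y i) => [] [].
have n_le8 : (n <= 8)%N.
  rewrite -[8%N]card_ord -sum1_card; apply: leq_sum => i _.
  exact: leq_b1.
apply/fifthsP; case: n n_gt0 n_le8 => // n _.
(* For 1, ..., 8 disagreements the inner products before scaling are 6, 6, 2, 2, -2, -2, -6, -6. *)
do 8?[case: n => [|n] //] => _; rewrite -signr_odd /= ?expr0 ?expr1.
- by constructor 3; field.
- by constructor 3; field.
- by constructor 1; field.
- by constructor 1; field.
- by constructor 2; field.
- by constructor 2; field.
- by constructor 4; field.
- by constructor 4; field.
Qed.

Section Lines.
Variables (k : nat) (Y : {fset 'rV[R]_k}).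
Hypothesis Y3 : third_set Y.

Let c : R := Num.sqrt 10.
Let b : R := Num.sqrt (3 / 5).

Let cc : c * c = 10.
Proof. by rewrite -expr2 sqr_sqrtr. Qed.

Let c_neq0 : c != 0.
Proof. by rewrite gt_eqF // sqrtr_gt0. Qed.

Let bb : b * b = 3 / 5.
Proof. by rewrite -expr2 sqr_sqrtr //; lra. Qed.

(** The coefficient [c / 5] is the square root of 2/5; written through [c], it cancels against
    [c^-1] to give exactly 1/5 in the mixed products. *)
Definition line (t : {ffun 'I_8 -> bool} + 'I_10 * bool * Y) :
    'rV[R]_(10 + k) :=
  match t with
  | inl x => row_mx (c^-1 *: even_sign x) 0
  | inr (i, e, y) =>
      row_mx ((c / 5 * (-1) ^+ e) *: delta_mx 0 i) (b *: fsval y)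
  end.

Lemma inner_line_inl x x' :
  inner (line (inl x)) (line (inl x')) =
  10^-1 * inner (even_sign x) (even_sign x').
Proof. by rewrite inner_row_mx inner0r addr0 innerZl innerZr mulrA -invfM cc. Qed.

Lemma inner_line_inr i e y i' e' y' :
  inner (line (inr (i, e, y))) (line (inr (i', e', y'))) =
  2 / 5 * (-1) ^+ (e (+) e') * (i == i')%:R +
  3 / 5 * inner (fsval y) (fsval y').
Proof.
rewrite inner_row_mx !innerZl !innerZr inner_delta mxE eqxx /= signr_addb.
rewrite [b * _]mulrA bb; congr (_ + _).
rewrite [X in X / 5](_ : 2 = c * c / 5); last by rewrite cc; field.
by ring.
Qed.

Lemma inner_line_inr_inl i e y x :
  inner (line (inr (i, e, y))) (line (inl x)) =
  5^-1 * (-1) ^+ (e (+) even_bit x i).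
Proof.
rewrite inner_row_mx inner0r addr0 innerZl innerZr inner_delta mxE signr_addb.
by field.
Qed.

Lemma line_norm t : inner (line t) (line t) = 1.
Proof.
case: t => [x|[[i e] y]].
  by rewrite inner_line_inl even_sign_norm mulVf ?pnatr_eq0.
by rewrite inner_line_inr addbb eqxx (proj1 Y3) ?fsvalP // expr0 /=; field.
Qed.

Lemma line_fifths t t' : t != t' -> inner (line t) (line t') \in fifths.
Proof.
have mix i e y x : inner (line (inr (i, e, y))) (line (inl x)) \in fifths.
  rewrite inner_line_inr_inl; apply/fifthsP.
  by case: (_ (+) _); [constructor 2|constructor 1]; field.
case: t t' => [x|[[i e] y]] [x'|[[i' e'] y']] tt' //.
- rewrite inner_line_inl; apply: even_sign_fifths.
  by apply: contraNneq tt' => ->.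
- by rewrite innerC.
rewrite inner_line_inr; apply/fifthsP.
have [yy'|yy'] := eqVneq y y'.
  rewrite -yy' (proj1 Y3) ?fsvalP //.
  have [ii'|_] := eqVneq i i'; last by constructor 3; rewrite mulr0; field.
  have -> : e (+) e' by apply: contraNT tt'; rewrite negb_add ii' yy' => /eqP ->.
  by constructor 1; rewrite expr1 /=; field.
have /(fsubsetP (proj2 Y3)) : inner (fsval y) (fsval y') \in inner_products Y.
  apply/imfset2P; exists (fsval y); first exact: fsvalP.
  exists (fsval y') => //; rewrite !inE fsvalP andbT.
  by apply: contra yy' => /eqP/val_inj->.
(* The [Y] part is now 1/5 or -1/5. It is shifted by 2/5 or -2/5 when [i] and [i'] coincide, and is
   unchanged otherwise. *)
rewrite !inE => /orP[] /eqP ->; have [_|_] := eqVneq i i';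
  case: (e (+) e'); rewrite ?expr1 ?expr0 /=.
- by constructor 2; field.
- by constructor 3; field.
- by constructor 1; field.
- by constructor 1; field.
- by constructor 4; field.
- by constructor 1; field.
- by constructor 2; field.
- by constructor 2; field.
Qed.

End Lines.
End Construction.

Theorem theorem2p13 (R : realType) (d : nat) (hd : (10 <= d)%N) :
  exists X : {fset 'rV[R]_d},
    [/\ unit_vectors X,
        spans_biangular_lines X,
        #|` X| = (256 + 20 * N_third R (d - 10))%N &
        (inner_products X `<=` [fset 1 / 5; - (1 / 5); 3 / 5; - (3 / 5)])%fset].
Proof.
have [k ->] : exists k, d = (10 + k)%N by exists (d - 10)%N; rewrite subnKC.
rewrite addKn.
have [Y Y3 <-] : exists2 Y : {fset 'rV[R]_k}, third_set Y & #|` Y| = N_third R k.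
  by rewrite /N_third; case: ex_maxnP => n /asboolP.
have [X [X1 X2 Xcard XA]] :=
  fset_of_family R (10 + k) _ (line R k Y) (line_norm R k Y Y3)
    (line_fifths R k Y Y3).
(* The index type has [2 ^ 8] sign patterns and 10 * 2 triples for each element of [Y]. *)
exists X; split=> //; rewrite Xcard card_sum card_ffun !card_prod.
by rewrite card_bool !card_ord cardfE.
Qed.
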